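(* The properties $\mathrm{Split}(B_\Omega,B_\Lambda)$, $\mathrm{Split}(\Omega,\Lambda)$ and $\mathrm{Split}(C_\Omega,C_\Lambda)$ are $\sigma$-additive: if a set of reals $Y$ is the union $Y=\bigcup_{n\in\mathbb N}X_n$ of subspaces each satisfying one of these properties, then $Y$ satisfies the same property.
   Context: A set of reals is an infinite topological space homeomorphic to a subset of $\mathbb R$. A cover of a space $X$ is a family $\mathcal U$ of subsets of $X$ with $\bigcup\mathcal U=X$ such that $X\not\subseteq U$ for all $U\in\mathcal U$; it is a large cover if every $x\in X$ lies in infinitely many members, and an $\omega$-cover if every finite subset of $X$ is contained in some member. $\Lambda,\Omega$ denote the collections of open large covers and open $\omega$-covers of $X$; $B_\Lambda,B_\Omega$ the collections of countable such covers by Borel sets; $C_\Lambda,C_\Omega$ the collections of countable such covers by clopen sets. $X$ satisfies $\mathrm{Split}(\mathfrak U,\mathfrak V)$ if every $\mathcal U\in\mathfrak U$ can be partitioned into two disjoint subfamilies each containing a subfamily belonging to $\mathfrak V$. *)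

(* Defs.v *)
From HB Require Import structures.
From mathcomp Require Import all_boot all_order all_algebra.
From mathcomp Require Import all_classical all_reals all_analysis.
Set Implicit Arguments. Unset Strict Implicit. Unset Printing Implicit Defensive.
Import Order.TTheory GRing.Theory Num.Theory numFieldNormedType.Exports.
Local Open Scope classical_set_scope.

Section Covers.
Variable R : realType.
Implicit Types (X U : set R) (F : set (set R)).

Definition is_cover X F :=
  [/\ (forall U, F U -> U `<=` X),
      X `<=` \bigcup_(U in F) U &
      (forall U, F U -> ~ (X `<=` U))].

Definition large_cover X F :=
  is_cover X F /\ forall x, X x -> infinite_set [set U | F U /\ U x].

Definition omega_cover X F :=
  is_cover X F /\
  forall A : set R, finite_set A -> A `<=` X -> exists2 U, F U & A `<=` U.

Definition rel_open X U := exists V : set R, open V /\ U = X `&` V.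
Definition rel_closed X U := exists V : set R, closed V /\ U = X `&` V.
Definition rel_borel X U := exists V : set R, measurable V /\ U = X `&` V.
Definition rel_clopen X U := rel_open X U /\ rel_closed X U.

Definition OmegaO X F := omega_cover X F /\ forall U, F U -> rel_open X U.
Definition LambdaO X F := large_cover X F /\ forall U, F U -> rel_open X U.
Definition B_Omega X F :=
  [/\ countable F, omega_cover X F & forall U, F U -> rel_borel X U].
Definition B_Lambda X F :=
  [/\ countable F, large_cover X F & forall U, F U -> rel_borel X U].
Definition C_Omega X F :=
  [/\ countable F, omega_cover X F & forall U, F U -> rel_clopen X U].
Definition C_Lambda X F :=
  [/\ countable F, large_cover X F & forall U, F U -> rel_clopen X U].

Definition SplitProp (frakU frakV : set R -> set (set R) -> Prop) X :=
  forall F, frakU X F ->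
    exists F1 F2 : set (set R),
      [/\ F1 `&` F2 = set0, F1 `|` F2 = F,
          (exists2 G, G `<=` F1 & frakV X G) &
          (exists2 G, G `<=` F2 & frakV X G)].

Definition sigma_additive_prop (P : set R -> Prop) :=
  forall X : nat -> set R,
    infinite_set (\bigcup_n X n) ->
    (forall n, P (X n)) -> P (\bigcup_n X n).

End Covers.

(* Main.v *)
Require Import Defs.
From HB Require Import structures.
From mathcomp Require Import all_boot all_order all_algebra.
From mathcomp Require Import all_classical all_reals all_analysis.

(** Let [F] be an omega-cover of [Y], the union of the [X n]. Splitting the
trace of an omega-cover of [Y] on [X n] splits the omega-cover itself into two
parts that are large on [X n], and one of these two parts is again an
omega-cover of [Y]. Hence one can peel off from [F], two at each step, pairwise
disjoint subfamilies [J 0, J' 0, J 1, J' 1, ...] with [J n] and [J' n] large on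
[X n]. The union of the [J n] and its complement in [F] split [F]. *)

Set Implicit Arguments. Unset Strict Implicit. Unset Printing Implicit Defensive.
Local Open Scope classical_set_scope.

(** An injection of the naturals into [A] does it: its values at even indices form [S], and those at
    odd indices stay outside [S]. *)
Lemma infinite_set_split (T : pointedType) (A : set T) : infinite_set A ->
  exists2 S, S `<=` A & infinite_set S /\ infinite_set (A `\` S).
Proof.
move=> /infiniteP /pcard_leP [f].
have finj : injective f by move=> a b; apply: inj; rewrite inE.
have inf_im (g : nat -> nat) : injective g -> infinite_set (range (f \o g)).
  move=> ginj; apply/infiniteP; rewrite (card_le_eqr (inj_card_eq _)) //.
  by move=> a b _ _ /finj/ginj.
exists (range (f \o double)); first by move=> _ [k _ <-]; exact: funS.
split; first by apply: inf_im; exact: double_inj.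
apply: (@sub_infinite_set _ (range (f \o (fun k => k.*2.+1)))); last first.
  by apply: inf_im => a b [/double_inj].
move=> _ [k _ <-]; split; first exact: funS.
by move=> [j _ /finj /(congr1 odd)] /=; rewrite !odd_double.
Qed.

Section Splitting.
Variable R : realType.
Implicit Types (X Y U : set R) (F I J : set (set R)).

(** Members of [F] may stick out of [X] or contain it, so subfamilies of a cover of [Y] can be
    tested on a subspace. *)
Definition large_on X F := forall x, X x -> infinite_set [set U | F U /\ U x].

Lemma large_onS X F J : F `<=` J -> large_on X F -> large_on X J.
Proof.
move=> FJ FX x /FX; apply: sub_infinite_set => U [FU Ux].
by split=> //; exact: FJ.
Qed.

(** If some finite [A] lies in no member of [J], then for every finite [B] the member containing the
    union of [A] and [B] comes from [I]. *)
Lemma omega_coverU Y I J : omega_cover Y (I `|` J) ->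
  omega_cover Y I \/ omega_cover Y J.
Proof.
move=> [[sub cov prop] om].
have coverP F : F `<=` I `|` J ->
    (forall A, finite_set A -> A `<=` Y -> exists2 U, F U & A `<=` U) ->
    omega_cover Y F.
  move=> FIJ omF; split=> //; split=> [U /FIJ|x Yx|U /FIJ]; [exact: sub| |exact: prop].
  have [||U FU xU] := omF [set x]; first exact: finite_set1.
    by move=> _ ->.
  by exists U => //; exact: xU.
have [?|] := pselect (omega_cover Y I); [by left|move=> nI; right].
apply: (coverP) => [U ?|A finA AY]; first by right.
apply: contrapT => nJ; apply: nI; apply: (coverP) => [U ?|B finB BY]; first by left.
have [||U [IU|JU] ABU] := om (A `|` B); first by rewrite finite_setU.
- by rewrite subUset.
- by exists U => // x Bx; apply: ABU; right.
- by case: nJ; exists U => // x Ax; apply: ABU; left.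
Qed.

(** Choose for each member a point of [Y] that it misses; if [F] were finite, these points would
    form a finite set inside no member. *)
Lemma omega_cover_infinite Y F : omega_cover Y F -> infinite_set F.
Proof.
move=> [[_ _ prop] om] finF.
have [w wP] : {w : set R -> R & forall U, F U -> Y (w U) /\ ~ U (w U)}.
  apply: (@choice _ _ (fun U x => F U -> Y x /\ ~ U x)) => U.
  have [FU|nFU] := pselect (F U); last by exists 0%R.
  apply: contrapT => nex; case: (prop U FU) => x Yx.
  by apply: contrapT => nUx; apply: nex; exists x.
have [||U FU wU] := om (w @` F); first exact: finite_image.
  by move=> _ [U FU <-]; case: (wP _ FU).
by case: (wP _ FU) => _; apply; apply: wU; exists U.
Qed.

(** [small] is countability or no restriction at all, and [reg X U] says that
[U] is relatively open, clopen or Borel in [X]. *)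
Variable small : set (set R) -> Prop.
Variable reg : set R -> set R -> Prop.
Hypothesis smallS : forall F J, F `<=` J -> small J -> small F.
Hypothesis small_image : forall (f : set R -> set R) F, small F -> small (f @` F).
Hypothesis reg_trace : forall X Y U, X `<=` Y -> reg Y U -> reg X (X `&` U).

Variables omega large : set R -> set (set R) -> Prop.
Hypothesis omegaE : forall X F, omega X F <->
  [/\ small F, omega_cover X F & forall U, F U -> reg X U].
Hypothesis largeE : forall X F, large X F <->
  [/\ small F, large_cover X F & forall U, F U -> reg X U].

Lemma omega_sub Y F I : omega Y F -> I `<=` F -> omega_cover Y I -> omega Y I.
Proof.
move=> /omegaE [sF _ rF] IF omI; apply/omegaE; split=> //.
  exact: smallS sF.
by move=> U /IF/rF.
Qed.

Lemma split_large_on X Y F : SplitProp omega large X -> X `<=` Y -> omega Y F ->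
  exists I J, [/\ I `&` J = set0, I `|` J = F, large_on X I & large_on X J].
Proof.
move=> splitX XY omF.
(* The members of [B] must be removed before taking traces on [X]; if there are
infinitely many of them, they already split into two parts large on [X]. *)
pose B := [set U | F U /\ X `<=` U].
have BF : B `<=` F by move=> U [].
have [finB|infB] := pselect (finite_set B); last first.
  have [S SB [infS infBS]] := infinite_set_split infB.
  have BX G : G `<=` B -> infinite_set G -> large_on X G.
    move=> GB infG x Xx; apply: sub_infinite_set infG => U GU.
    by split=> //; apply: (GB _ GU).2.
  exists S, (F `\` S); split; first by rewrite setDIK.
  - by rewrite setDUK // => U /SB/BF.
  - exact: BX.
  - by apply: large_onS (BX _ _ infBS) => [U [/BF]|U []].
(* A finite [B] cannot be an omega-cover, so the other part of [F] is one. *)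
have omFB : omega_cover Y (F `\` B).
  have /omegaE [_ + _] := omF; rewrite -{1}(setDUK BF) => /omega_coverU [|//].
  by move=> /omega_cover_infinite.
have [|F1 [F2 [F12 F1F2 [G1 G1F1 large1] [G2 G2F2 large2]]]] :=
    splitX (setI X @` (F `\` B)).
  have /omegaE [sFB [_ om] rFB] := omega_sub omF (@subDsetl _ _ _) omFB.
  have om' A : finite_set A -> A `<=` X ->
      exists2 U, (setI X @` (F `\` B)) U & A `<=` U.
    move=> finA AX; have [|U FU AU] := om A finA; first exact: subset_trans XY.
    by exists (X `&` U); [exists U|rewrite subsetI].
  apply/omegaE; split; first exact: small_image.
    split=> //; split=> [_ [U _ <-]|x Xx|_ [U [FU nBU] <-]].
    - exact: subIsetl.
    - have [||U FU xU] := om' [set x]; first exact: finite_set1.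
        by move=> _ ->.
      by exists U => //; exact: xU.
    - by rewrite subsetI => -[_ XU]; exact: nBU.
  by move=> _ [U FU <-]; apply: reg_trace XY _; exact: rFB.
(* Finitely many members of [H] through [x] would leave only finitely many traces in [G] through
   [x]. *)
have pullback G H : G `<=` setI X @` (F `\` B) -> large X G ->
    (forall U, (F `\` B) U -> G (X `&` U) -> H U) -> large_on X H.
  move=> GF /largeE [_ [_ lG] _] GH x Xx /(finite_image (setI X)).
  apply: sub_infinite_set (lG x Xx) => V [GV Vx].
  have [U FU UV] := GF _ GV; exists U; last by [].
  move: GV Vx; rewrite -UV => GU [_ Ux].
  by split=> //; exact: GH.
(* Sorting by trace sends members with equal traces to the same side, so disjointness of [F1] and
   [F2] passes to [F]. *)
pose I := [set U | F U /\ F1 (X `&` U)].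
have IF : I `<=` F by move=> U [].
exists I, (F `\` I); split; [by rewrite setDIK | by rewrite setDUK | |].
- apply: (pullback G1) => //; first by rewrite -F1F2 => U /G1F1; left.
  by move=> U [FU _] /G1F1.
- apply: (pullback G2) => //; first by rewrite -F1F2 => U /G2F2; right.
  move=> U [FU _] /G2F2 F2U; split=> // -[_ F1U].
  by have : (F1 `&` F2) (X `&` U) by []; rewrite F12.
Qed.

(** One half of the splitting is still an omega-cover and is kept as [I] for further peeling; the
    other half becomes [J]. *)
Lemma peel_large_on X Y F : SplitProp omega large X -> X `<=` Y -> omega Y F ->
  exists J I, [/\ J `<=` F, I `<=` F, J `&` I = set0, large_on X J & omega Y I].
Proof.
move=> splitX XY omF; have [I [J [IJ IJF lI lJ]]] := split_large_on splitX XY omF.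
have IF : I `<=` F by rewrite -IJF => U; left.
have JF : J `<=` F by rewrite -IJF => U; right.
have [_ omIJ _] := (omegaE Y F).1 omF.
have [omI|omJ] : omega_cover Y I \/ omega_cover Y J.
- by apply: omega_coverU; rewrite IJF.
- by exists J, I; rewrite setIC; split=> //; exact: omega_sub omF _ omI.
- by exists I, J; split=> //; exact: omega_sub omF _ omJ.
Qed.

Lemma split_sigma_additive : sigma_additive_prop (SplitProp omega large).
Proof.
move=> X _ splitX F omF; set Y := \bigcup_n X n in omF *.
have XY n : X n `<=` Y by move=> x Xx; exists n.
(* One stage peels twice on the same [X n]; the triple holds the two peeled families and the
   remainder. Families that are not omega-covers get a dummy triple, so that choice yields a total
   function. *)
have step (p : nat * set (set R)) : exists t : set (set R) * set (set R) * set (set R),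
    omega Y p.2 -> [/\ [/\ t.1.1 `<=` p.2, t.1.2 `<=` p.2 & t.2 `<=` p.2],
      [/\ t.1.1 `&` t.1.2 = set0, t.1.1 `&` t.2 = set0 & t.1.2 `&` t.2 = set0],
      large_on (X p.1) t.1.1, large_on (X p.1) t.1.2 & omega Y t.2].
  case: p => n I; have [omI|] := pselect (omega Y I); last first.
    by exists (set0, set0, set0).
  have [J [K [JI KI JK lJ omK]]] := peel_large_on (splitX n) (XY n) omI.
  have [J' [L [J'K LK J'L lJ' omL]]] := peel_large_on (splitX n) (XY n) omK.
  exists (J, J', L) => _ /=; split=> //; split=> //.
  - exact: subset_trans KI.
  - exact: subset_trans KI.
  - by apply: subsetI_eq0 JK.
  - by apply: subsetI_eq0 JK.
have {step} [t tP] := choice step.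
pose I := fix I n := if n is k.+1 then (t (k, I k)).2 else F.
have omI n : omega Y (I n) by elim: n => //= n /(tP (n, _)) [].
pose J n := (t (n, I n)).1.1; pose J' n := (t (n, I n)).1.2.
have IS n : I n.+1 `<=` I n by have [[]] := tP (n, I n) (omI n).
have Ile m n : (m <= n)%N -> I n `<=` I m.
  move=> /subnK <-; elim: (n - m)%N => // k IH.
  exact: subset_trans (IS _) IH.
have JI n : J n `<=` I n by have [[]] := tP (n, I n) (omI n).
have J'I n : J' n `<=` I n by have [[]] := tP (n, I n) (omI n).
have JIS n : J n `&` I n.+1 = set0 by have [_ []] := tP (n, I n) (omI n).
have J'IS n : J' n `&` I n.+1 = set0 by have [_ []] := tP (n, I n) (omI n).
(* For distinct indices, the family peeled later lies in the remainder of the earlier stage, which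
   the earlier family avoids. *)
have JJ' m n U : J m U -> J' n U -> False.
  move=> JU J'U; case: (ltngtP m n) => [mn|nm|eq_mn].
  - by rewrite -[False]/(set0 U) -(JIS m); split=> //; apply: (Ile _ n) => //; exact: J'I.
  - by rewrite -[False]/(set0 U) -(J'IS n); split=> //; apply: (Ile _ m) => //; exact: JI.
  - have [_ [disj _ _] _ _ _] := tP (n, I n) (omI n).
    by rewrite -[False]/(set0 U) -disj; split=> //; move: JU; rewrite eq_mn.
have JF n : J n `<=` F by apply: subset_trans (Ile 0%N n _).
have J'F n : J' n `<=` F by apply: subset_trans (Ile 0%N n _).
(* Each point of [Y] lies in some [X n], where [K n] alone supplies infinitely many members. *)
have largeP G K : G `<=` F -> (forall n, K n `<=` G) ->
    (forall n, large_on (X n) (K n)) -> large Y G.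
  move=> GF KG lK; have /omegaE [sF [[sub _ prop] _] rF] := omF.
  have lG x : Y x -> infinite_set [set U | G U /\ U x].
    by move=> [n _ Xx]; exact: (large_onS (KG n) (lK n)).
  apply/largeE; split; [exact: smallS sF| |by move=> U /GF/rF].
  split=> //; split=> [U /GF/sub //|x /lG|U /GF/prop //].
  by move=> /infinite_setN0 [U [GU Ux]]; exists U.
(* The complement contains every [J' n] and also absorbs the members of [F] that are never peeled
   off. *)
exists (\bigcup_n J n), (F `\` \bigcup_n J n).
have J_F : \bigcup_n J n `<=` F by move=> U [n _ /JF].
split; [by rewrite setDIK | by rewrite setDUK | |].
- exists (\bigcup_n J n) => //; apply: (largeP _ J) => // n.
    by move=> U ?; exists n.
  by have [] := tP (n, I n) (omI n).
- exists (F `\` \bigcup_n J n) => //; apply: (largeP _ J') => [U []//|n U J'U|n].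
    by split=> [|[m _ JU]]; [exact: J'F J'U | exact: JJ' JU J'U].
  by have [] := tP (n, I n) (omI n).
Qed.

End Splitting.

Lemma trace_witness (T : Type) (P : set T -> Prop) (X Y U : set T) : X `<=` Y ->
  (exists V, P V /\ U = Y `&` V) -> exists V, P V /\ X `&` U = X `&` V.
Proof.
by move=> XY [V [PV ->]]; exists V; rewrite setIA (setIidl XY).
Qed.

Theorem theorem6p6 (R : realType) :
  [/\ sigma_additive_prop (SplitProp (@B_Omega R) (@B_Lambda R)),
      sigma_additive_prop (SplitProp (@OmegaO R) (@LambdaO R)) &
      sigma_additive_prop (SplitProp (@C_Omega R) (@C_Lambda R))].
Proof.
have countableS (F J : set (set R)) : F `<=` J -> countable J -> countable F.
  by move=> FJ; exact: sub_countable (subset_card_le FJ).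
have countable_im (f : set R -> set R) (F : set (set R)) :
    countable F -> countable (f @` F) by exact: sub_countable (card_image_le f F).
split.
- apply: (@split_sigma_additive R (@countable _) (@rel_borel R)) => //.
  by move=> X Y U; exact: trace_witness.
- apply: (@split_sigma_additive R (fun=> True) (@rel_open R)) => //.
  + by move=> X Y U; exact: trace_witness.
  + by move=> X F; split=> [[]|[]].
  + by move=> X F; split=> [[]|[]].
- apply: (@split_sigma_additive R (@countable _) (@rel_clopen R)) => //.
  by move=> X Y U XY [oU cU]; split; exact: (trace_witness XY).
Qed.
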